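(* Let $(x^{*},y^{*})$ be a saddle-point of $f$, and let $((x^k,y^k))_{k\in\mathbf N}$ be generated by the alternating proximal mapping method with constant parameters: for all $k\in\mathbf N\cup\{-1\}$, $\tau_k=\tau\in\mathbf R_{++}$, $\sigma_k=\sigma\in\mathbf R_{++}$, $\alpha_k=\alpha\in\mathbf R_{++}$, $\beta_k=\beta\in\mathbf R_+$. Let $\tau,\sigma>0$ be small enough that $\|K\|^2<\frac{\mu+\frac1\tau}{\sigma}$ and $\|K\|^2<\frac{\nu+\frac1\sigma}{\tau}$. Let $\alpha\in\big(\frac1{\mu\tau+1},1\big)$ be such that $\alpha\ge\frac1{\nu\sigma+1}$ and $\alpha\tau\sigma\|K\|^2<1$. Let $\beta$ satisfy $\|K\|^2\beta^2\sigma<\big(\mu+\frac1\tau-\frac1{\alpha\tau}\big)(1-\alpha\tau\sigma\|K\|^2)$. Let $\eta_4\in\mathbf R_{++}$ satisfy $\tau\le\eta_4$ and $\alpha\sigma\eta_4\|K\|^2<1$. Suppose $\eta_1,\eta_2,\eta_3\in\mathbf R_{++}$ satisfy one of the following. (i) $\frac{\sigma\|K\|}{1-\alpha\tau\sigma\|K\|^2}<\eta_3$ and $\eta_3\|K\|\beta^2\le\mu+\frac1\tau-\frac1{\alpha\tau}$; $\ \eta_1\ge\frac{\sigma\|K\|\eta_3}{\eta_3-\sigma\|K\|}$ and $\alpha\tau\eta_1\|K\|<1$; $\ \eta_2\ge\frac{\tau\|K\|}{\alpha-\tau\eta_1\|K\|\alpha^2}$. (ii) $\eta_3>\frac{\sigma}{1-\alpha\tau\sigma\|K\|^2}$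 and $\|K\|^2\beta^2\eta_3\le\mu+\frac1\tau-\frac1{\alpha\tau}$; $\ \eta_1\ge\frac{\sigma\eta_3}{\eta_3-\sigma}$ and $\alpha\tau\eta_1\|K\|^2<1$; $\ \eta_2\ge\frac{\tau}{\alpha(1-\alpha\tau\eta_1\|K\|^2)}$. For $k\in\mathbf N$ set $\hat x_k=\frac1{\sum_{j=0}^k\alpha^{-j}}\sum_{i=0}^k\alpha^{-i}x^{i+1}$ and $\hat y_k=\frac1{\sum_{j=0}^k\alpha^{-j}}\sum_{i=0}^k\alpha^{-i}y^{i+1}$. Then there exists $M\in\mathbf R_{++}$ such that for every $k\in\mathbf N$, $$f(\hat x_k,\hat y_k)-f(x^*,y^* )\le\alpha^k\Big(\frac1{2\tau}\|x^*-x^0\|^2+\frac1{2\sigma}\|\hat y_k-y^0\|^2\Big)\le\alpha^kM,$$ $$f(x^*,y^* )-f(\hat x_k,\hat y_k)\le\alpha^k\Big(\frac1{2\tau}\|\hat x_k-x^0\|^2+\frac1{2\sigma}\|y^*-y^0\|^2\Big)\le\alpha^kM.$$ Consequently, $(f(\hat x_k,\hat y_k))_{k\in\mathbf N}$ converges linearly to $f(x^*,y^* )$ with rate $\alpha\in(0,1)$.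
   Context: $\mathbf N=\{0,1,2,\dots\}$, $\mathbf R_+=[0,\infty)$, $\mathbf R_{++}=(0,\infty)$. $\mathcal H_1,\mathcal H_2$ are real Hilbert spaces; $K:\mathcal H_1\to\mathcal H_2$ is a continuous linear operator with operator norm $\|K\|$ and adjoint $K^*$. $g:\mathcal H_1\to\mathbf R\cup\{+\infty\}$ and $h:\mathcal H_2\to\mathbf R\cup\{+\infty\}$ are proper and lower semicontinuous; $\mu,\nu\in\mathbf R_{++}$; $g$ is strongly convex with modulus $\mu$, i.e. $\langle u,x-\bar x\rangle+\frac\mu2\|x-\bar x\|^2+g(\bar x)\le g(x)$ for all $\bar x\in\operatorname{dom}\partial g$, $u\in\partial g(\bar x)$, $x\in\mathcal H_1$; and $h$ is strongly convex with modulus $\nu$ (same inequality with $h,\nu,\mathcal H_2$). Define $f(x,y)=\langle Kx,y\rangle+g(x)-h(y)$ on $\mathcal H_1\times\mathcal H_2$. A saddle-point of $f$ is $(x^*,y^* )$ with $f(x^*,y)\le f(x^*,y^* )\le f(x,y^* )$ for all $x\in\mathcal H_1,y\in\mathcal H_2$; one is assumed to exist. Alternating proximal mapping method: given sequences $(\tau_k)_{k\in\mathbf N\cup\{-1\}}$, $(\sigma_k)_{k\in\mathbf N\cup\{-1\}}$ in $\mathbf R_{++}$ and $(\alpha_k)_{k\in\mathbf N\cup\{-1\}}$, $(\beta_k)_{k\in\mathbf N\cup\{-1\}}$ in $\mathbf R_+$, and $(x^0,y^0)\in\mathcal H_1\times\mathcal H_2$, set $x^{-1}=x^0$, $y^{-1}=y^0$,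 $\bar x^0=x^0$, $\bar y^0=y^0$ and for every $k\in\mathbf N$: $y^{k+1}=\operatorname{Prox}_{\sigma_kh}(\sigma_kK\bar x^k+y^k)$; $\bar y^{k+1}=y^{k+1}+\beta_k(y^{k+1}-y^k)$; $x^{k+1}=\operatorname{Prox}_{\tau_kg}(-\tau_kK^*\bar y^{k+1}+x^k)$; $\bar x^{k+1}=x^{k+1}+\alpha_k(x^{k+1}-x^k)$. Here $\operatorname{Prox}_\varphi(z)=\operatorname{argmin}_w(\varphi(w)+\frac12\|z-w\|^2)$. *)

(* Defs.v *)
From HB Require Import structures.
From mathcomp Require Import all_boot all_order all_algebra.
From mathcomp Require Import all_classical all_reals all_analysis.

Set Implicit Arguments.
Unset Strict Implicit.
Unset Printing Implicit Defensive.

Import Order.TTheory GRing.Theory Num.Theory.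
Import numFieldNormedType.Exports.

Local Open Scope classical_set_scope.
Local Open Scope ring_scope.

(* A real Hilbert space: a complete normed space whose norm is the one induced
   by a (real, hence [idfun]-sesquilinear) inner product. *)
HB.mixin Record isHilbert (R : realType) V & CompleteNormedModule R V := {
  inner : {dot V for (@idfun R)};
  inner_norm : forall x : V, inner x x = `|x| ^+ 2
}.

#[short(type="hilbertType")]
HB.structure Definition Hilbert (R : realType) :=
  {V of isHilbert R V & CompleteNormedModule R V}.

Notation "''[' x , y ]" := (inner x y)
  (at level 0, format "''[' x ,  y ]") : ring_scope.

Section operators.
Context (R : realType) (H1 H2 : hilbertType R).

Definition opnorm (K : H1 -> H2) : R :=
  sup [set `|K x| | x in [set x : H1 | `|x| <= 1]].

Definition is_adjoint (K : H1 -> H2) (Kstar : H2 -> H1) : Prop :=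
  forall x y, '[K x, y] = '[x, Kstar y].

End operators.

Section convex_analysis.
Context (R : realType) (H : hilbertType R).
Implicit Types (g : H -> \bar R) (x u z w : H).

(* Functions to R ∪ {+oo} are functions to [\bar R] avoiding [-oo]. *)
Definition proper_function g : Prop :=
  (forall x, (-oo < g x)%E) /\ (exists x, (g x < +oo)%E).

Definition econvex g : Prop :=
  forall x y (t : R), 0 <= t <= 1 ->
    (g (t *: x + (1 - t) *: y)%R <= t%:E * g x + (1 - t)%:E * g y)%E.

Definition subdifferential g x : set H :=
  [set u | forall z, ('[u, (z - x)%R]%:E + g x <= g z)%E].

Definition dom_subdifferential g : set H :=
  [set x | subdifferential g x !=set0].

(* The inequality alone is vacuous where the subdifferential is empty (it holds
   for g = - |.|^2, say): convexity is a separate part of strong convexity. *)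
Definition strongly_convex (mu : R) g : Prop :=
  econvex g /\
  forall xbar u x, dom_subdifferential g xbar -> subdifferential g xbar u ->
    (('[u, (x - xbar)%R] + mu / 2 * `|x - xbar| ^+ 2)%R%:E + g xbar <= g x)%E.

Definition argmin (phi : H -> \bar R) : set H :=
  [set w | forall z, (phi w <= phi z)%E].

(* [Prox phi z] is the set of minimizers, a singleton for a proper, convex and
   lower semicontinuous [phi]. *)
Definition Prox (phi : H -> \bar R) z : set H :=
  argmin (fun w => (phi w + (2^-1 * `|z - w| ^+ 2)%R%:E)%E).

End convex_analysis.

Section saddle_point_problem.
Context (R : realType) (H1 H2 : hilbertType R).

(* At points with g x = h y = +oo the sum is the undefined +oo - oo and [adde] gives
   -oo. The choice is immaterial: for proper g and h, such a point is a
   saddle-point under no convention, and whether another point is one does not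
   depend on it. *)
Definition bilinear_saddle_function (K : H1 -> H2) (g : H1 -> \bar R)
    (h : H2 -> \bar R) (x : H1) (y : H2) : \bar R :=
  ('[K x, y]%:E + g x - h y)%E.

Definition saddle_point (f : H1 -> H2 -> \bar R) (xs : H1) (ys : H2) : Prop :=
  forall x y, (f xs y <= f xs ys)%E /\ (f xs ys <= f x ys)%E.

(* The parameters are indexed by the iterations k >= 0 that use them; the
   entries of index -1 do not enter the iteration. *)
Definition alternating_proximal_mapping_method
    (K : H1 -> H2) (Kstar : H2 -> H1) (g : H1 -> \bar R) (h : H2 -> \bar R)
    (tau sigma alpha beta : nat -> R)
    (x xbar : nat -> H1) (y ybar : nat -> H2) : Prop :=
  [/\ xbar 0%N = x 0%N, ybar 0%N = y 0%N &
   forall k : nat,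
   [/\ Prox (fun w => (sigma k)%:E * h w)%E
         (sigma k *: K (xbar k) + y k) (y k.+1),
       ybar k.+1 = y k.+1 + beta k *: (y k.+1 - y k),
       Prox (fun w => (tau k)%:E * g w)%E
         (- (tau k *: Kstar (ybar k.+1)) + x k) (x k.+1) &
       xbar k.+1 = x k.+1 + alpha k *: (x k.+1 - x k)]].

End saddle_point_problem.

Definition geometric_average (R : realType) (H : hilbertType R) (alpha : R)
    (x : nat -> H) (k : nat) : H :=
  (\sum_(0 <= j < k.+1) alpha ^- j)^-1 *:
    \sum_(0 <= i < k.+1) (alpha ^- i *: x i.+1).

Definition converges_linearly (R : realType) (u : nat -> \bar R) (l : \bar R)
    (rate : R) : Prop :=
  [/\ 0 < rate < 1, u @ \oo --> l &
      exists2 C : R, 0 < C & forall k, (`|u k - l| <= (rate ^+ k * C)%:E)%E].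

(* Main.v *)
(* With d_k = x^k - x^{k-1} and the energy
     V_k(x, y) = |x - x^k|^2 / 2 tau + |y - y^k|^2 / 2 sigma
                 + alpha |d_k|^2 / 2 tau - alpha <K d_k, y - y^k>,
   the strong convexity inequalities at the two proximal points add up to
     f(x^{k+1}, y) - f(x, y^{k+1}) <= V_k - V_{k+1} / alpha,
   the cross terms being absorbed by Young's inequality: this is what the
   condition on beta allows. Weighting by alpha^{-k} makes the right-hand side
   telescope, and Jensen's inequality moves the averages inside f. The energy
   dominates the squared distances to (x, y), so for the saddle-point, where the
   left-hand side is nonnegative, the iterates and their averages are bounded. *)
Require Import Defs.
From HB Require Import structures.
From mathcomp Require Import all_boot all_order all_algebra.
From mathcomp Require Import all_classical all_reals all_analysis.
From mathcomp Require Import ring lra.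
Set Implicit Arguments.
Unset Strict Implicit.
Unset Printing Implicit Defensive.
Import Order.TTheory GRing.Theory Num.Theory.
Import numFieldNormedType.Exports.
Local Open Scope classical_set_scope.
Local Open Scope ring_scope.

(** * Bilinearity, the three-point identity and the Cauchy-Schwarz inequality *)

Section inner_product.
Context (R : realType) (H : hilbertType R).
Implicit Types u v w : H.

Lemma innerC u v : '[u, v] = '[v, u].
Proof. by rewrite hermC expr0 mul1r. Qed.

Lemma innerDl u v w : '[u + v, w] = '[u, w] + '[v, w].
Proof. exact: linearDl. Qed.

Lemma innerNl u w : '[- u, w] = - '[u, w].
Proof. exact: linearNl. Qed.

Lemma innerZl (a : R) u w : '[a *: u, w] = a * '[u, w].
Proof. exact: linearZl_LR. Qed.

Lemma innerDr u v w : '[w, u + v] = '[w, u] + '[w, v].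
Proof. exact: linearDr. Qed.

Lemma innerNr u w : '[w, - u] = - '[w, u].
Proof. exact: linearNr. Qed.

Lemma innerZr (a : R) u w : '[w, a *: u] = a * '[w, u].
Proof. by rewrite innerC innerZl innerC. Qed.

Definition innerE := (innerDl, innerDr, innerNl, innerNr, innerZl, innerZr).

(** With v a proximal point, this turns the inner product of the optimality condition into the
    squared distances that make up the energy. *)
Lemma three_point u v w :
  2 * '[u - v, w - v] = `|u - v| ^+ 2 + `|w - v| ^+ 2 - `|w - u| ^+ 2.
Proof.
rewrite -!inner_norm !innerE (innerC w u) (innerC v u) (innerC v w); ring.
Qed.

(** The square of [|v| u - |u| v] expands to 2 |u| |v| (|u| |v| - <u, v>), and it is nonnegative. *)
Lemma inner_le_norm u v : '[u, v] <= `|u| * `|v|.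
Proof.
have [->|u0] := eqVneq u 0; first by rewrite linear0l normr0 mul0r.
have [->|v0] := eqVneq v 0; first by rewrite linear0r normr0 mulr0.
have uv_gt0 : 0 < `|u| * `|v| by rewrite mulr_gt0 ?normr_gt0.
have := sqr_ge0 (`| `|v| *: u - `|u| *: v |).
rewrite -inner_norm !innerE (innerC v u) !inner_norm => uv.
rewrite -(ler_pM2l uv_gt0); nra.
Qed.

End inner_product.

(** * The operator norm and Young's inequality for the coupling term *)

Section operator_norm.
Context (R : realType) (H1 H2 : hilbertType R) (K : {linear H1 -> H2}).
Hypothesis K_cont : continuous K.

(** [sup] takes a default value on unbounded sets; continuity of [K] at 0 excludes this case for
    [opnorm]. *)
Lemma has_sup_opnorm : has_sup [set `|K x| | x in [set x : H1 | `|x| <= 1]].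
Proof.
split; first by exists `|K 0|; exists 0; rewrite //= normr0 ler01.
have /bounded_funP/(_ 1)[M KM] := continuous_linear_bounded 0 (@K_cont 0).
by exists M => _ /= [x x1 <-]; exact: KM.
Qed.

Lemma le_opnorm u : `|K u| <= opnorm K * `|u|.
Proof.
have [->|u0] := eqVneq u 0; first by rewrite linear0 !normr0 mulr0.
have nu0 : 0 < `|u| by rewrite normr_gt0.
rewrite -ler_pdivrMr// mulrC -[`|u|^-1]ger0_norm ?invr_ge0// -normrZ -linearZ.
apply: ub_le_sup; first exact: (has_sup_opnorm).2.
by exists (`|u|^-1 *: u); rewrite //= normrZ normfV normr_id mulVf ?lt0r_neq0.
Qed.

(** After Cauchy-Schwarz the slack is a perfect square over 2t. The weight t stays free: the energy
    estimates take 1/tau and c. *)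
Lemma inner_opnorm_young (t : R) u v : 0 < t ->
  '[K u, v] <= t / 2 * `|u| ^+ 2 + opnorm K ^+ 2 / (2 * t) * `|v| ^+ 2.
Proof.
move=> t0; apply: (le_trans (inner_le_norm _ _)).
apply: (@le_trans _ _ (opnorm K * `|u| * `|v|)).
  by rewrite ler_wpM2r// le_opnorm.
rewrite -subr_ge0.
have -> : t / 2 * `|u| ^+ 2 + opnorm K ^+ 2 / (2 * t) * `|v| ^+ 2 -
    opnorm K * `|u| * `|v| = (t * `|u| - opnorm K * `|v|) ^+ 2 / (2 * t).
  by field; lra.
by rewrite divr_ge0 ?sqr_ge0//; lra.
Qed.

End operator_norm.

(** * Variational inequality at a proximal point, and Jensen's inequality *)

Section proximal_point.
Context (R : realType) (H : hilbertType R) (g : H -> \bar R).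
Hypothesis g_proper : proper_function g.

Lemma proper_fin_num x : (g x < +oo)%E -> g x \is a fin_num.
Proof. by move=> gx; rewrite fin_numElt g_proper.1. Qed.

Lemma Prox_fin_num (s : R) z p : 0 < s ->
  Prox (fun w => s%:E * g w)%E z p -> g p \is a fin_num.
Proof.
move=> s0 pz; have [w gw] := g_proper.2.
apply: proper_fin_num; rewrite ltNge leye_eq; apply/negP => /eqP gp.
have := pz w; rewrite gp gt0_muley ?lte_fin// addye//.
by rewrite -(fineK (proper_fin_num gw)) -EFinM -EFinD leye_eq.
Qed.

Lemma Prox_subdifferential (s : R) z p : econvex g -> 0 < s ->
  Prox (fun w => s%:E * g w)%E z p -> subdifferential g p (s^-1 *: (z - p)).
Proof.
move=> g_cvx s0 pz w; have gp := Prox_fin_num s0 pz.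
have [->|gw] := eqVneq (g w) +oo%E; first exact: leey.
have {}gw : g w \is a fin_num by rewrite proper_fin_num// ltey.
rewrite -(fineK gp) -(fineK gw) -EFinD lee_fin.
(* Optimality of p against p + t (w - p), divided by t; then t tends to 0. *)
have key t : 0 < t -> t <= 1 ->
    s * fine (g p) + '[z - p, w - p] <= s * fine (g w) + t / 2 * `|w - p| ^+ 2.
  move=> t0 t1; have tP : 0 <= t <= 1 by rewrite ltW.
  have cvx := g_cvx w p t tP.
  rewrite -(fineK gp) -(fineK gw) -!EFinM -EFinD in cvx.
  have gtp : g (t *: w + (1 - t) *: p) \is a fin_num.
    by rewrite proper_fin_num// (le_lt_trans cvx)// ltry.
  have := pz (t *: w + (1 - t) *: p); move: cvx.
  rewrite -(fineK gtp) lee_fin -(fineK gp) -!EFinM -!EFinD lee_fin.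
  have -> : z - (t *: w + (1 - t) *: p) = (z - p) - t *: (w - p).
    by rewrite scalerBl scale1r scalerBr !opprD !addrA opprK (addrAC z).
  rewrite -!inner_norm; move: (z - p) (w - p) => a b.
  rewrite !innerE (innerC b a) => cvx opt; rewrite -(ler_pM2l t0).
  have := ler_wpM2l (ltW s0) cvx; lra.
rewrite innerZl; set B := '[_, _] in key *; set q := `|_| ^+ 2 in key.
have q0 : 0 <= q by exact: sqr_ge0.
rewrite -(ler_pM2l s0) mulrDr mulrA mulfV ?lt0r_neq0// mul1r addrC.
rewrite leNgt; apply/negP => gap.
(* The limit is replaced by one explicit t. By [key], the gap e is at most t q / 2 for every t in
   (0, 1]; but t = e / (e + q + 1) lies in (0, 1] and gives t q < e. *)
set e := s * fine (g p) + B - s * fine (g w).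
have e0 : 0 < e by rewrite subr_gt0.
have t0 : 0 < e / (e + q + 1) by rewrite divr_gt0//; lra.
have t1 : e / (e + q + 1) <= 1 by rewrite ler_pdivrMr; lra.
have := key _ t0 t1.
suff : e / (e + q + 1) * q < e by rewrite /e; lra.
by rewrite mulrAC ltr_pdivrMr ?ltr_pM2l//; lra.
Qed.

Lemma Prox_strongly_convex (mu s : R) z p w : strongly_convex mu g -> 0 < s ->
  Prox (fun w => s%:E * g w)%E z p -> g w \is a fin_num ->
  s^-1 * '[z - p, w - p] + mu / 2 * `|w - p| ^+ 2 + fine (g p) <= fine (g w).
Proof.
move=> [g_cvx g_sc] s0 pz gw.
have gp := Prox_fin_num s0 pz; have up := Prox_subdifferential g_cvx s0 pz.
have := g_sc p (s^-1 *: (z - p)) w (ex_intro _ _ up) up.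
by rewrite -{1}(fineK gp) -(fineK gw) -EFinD lee_fin innerZl.
Qed.

(** Jensen by induction: if S is the sum of the weights so far and w the next one, the new average
    is the convex combination of the old average and the new point with t = S / (S + w). *)
Lemma econvex_weighted_average (wt : nat -> R) (u : nat -> H) k :
  econvex g -> (forall i, 0 < wt i) -> (forall i, g (u i) \is a fin_num) ->
  (g ((\sum_(0 <= i < k.+1) wt i)^-1 *: \sum_(0 <= i < k.+1) wt i *: u i) <=
   ((\sum_(0 <= i < k.+1) wt i)^-1 *
     \sum_(0 <= i < k.+1) wt i * fine (g (u i)))%:E)%E.
Proof.
move=> g_cvx wt0 gu; elim: k => [|k IH].
  rewrite !big_nat1 scalerA mulrA mulVf ?lt0r_neq0// scale1r mul1r.
  by rewrite fineK.
rewrite !(big_nat_recr k.+1)//=.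
set S := \sum_(0 <= i < k.+1) wt i in IH *.
have S0 : 0 < S.
  by rewrite /S big_nat_recr//= ltr_wpDl// sumr_ge0// => i _; exact: ltW.
have SW0 : 0 < S + wt k.+1 by rewrite addr_gt0.
set U := \sum_(_ <= i < _) wt i *: _ in IH *.
set G := \sum_(_ <= i < _) wt i * _ in IH *.
pose t := S / (S + wt k.+1).
have t01 : 0 <= t <= 1.
  by rewrite /t divr_ge0 ?(ltW S0, ltW SW0)//= ler_pdivrMr// mul1r lerDl ltW.
have -> : (S + wt k.+1)^-1 *: (U + wt k.+1 *: u k.+1) =
    t *: (S^-1 *: U) + (1 - t) *: u k.+1.
  rewrite scalerDr !scalerA; congr (_ *: _ + _ *: _); rewrite /t; field; lra.
apply: (le_trans (g_cvx _ _ _ t01)).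
apply: (@le_trans _ _ (t%:E * (S^-1 * G)%:E + (1 - t)%:E * g (u k.+1)))%E.
  by rewrite leeD2r// lee_wpmul2l// lee_fin; case/andP: t01.
rewrite -{1}(fineK (gu k.+1)) -!EFinM -EFinD lee_fin le_eqVlt; apply/orP; left.
by apply/eqP; rewrite /t; field; lra.
Qed.

End proximal_point.

(** * Lower bound and one-step decrease of the energy *)

Section energy.
Context (R : realType) (H1 H2 : hilbertType R).
Variables (K : {linear H1 -> H2}) (Kstar : H2 -> H1).
Hypotheses (K_cont : continuous K) (Kstar_adj : is_adjoint K Kstar).
Variables (mu nu tau sigma alpha beta : R).
Hypotheses (tau_gt0 : 0 < tau) (sigma_gt0 : 0 < sigma) (alpha_gt0 : 0 < alpha).
Let n := opnorm K.
Variable c : R.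
Hypothesis cE : c = mu + 1 / tau - 1 / (alpha * tau).

Definition energy (x : H1) (y : H2) (xk dk : H1) (yk : H2) : R :=
  (2 * tau)^-1 * `|x - xk| ^+ 2 + (2 * sigma)^-1 * `|y - yk| ^+ 2 +
  alpha * (2 * tau)^-1 * `|dk| ^+ 2 - alpha * '[K dk, y - yk].

(** Young with weight 1/tau uses up exactly the |dk|^2 term of the energy, and the slack of Young is
    the difference of the two sides. *)
Lemma energy_ge x y xk dk yk :
  (2 * tau)^-1 * `|x - xk| ^+ 2 +
    (1 - alpha * tau * sigma * n ^+ 2) / (2 * sigma) * `|y - yk| ^+ 2 <=
  energy x y xk dk yk.
Proof.
have it0 : 0 < tau^-1 by rewrite invr_gt0.
have := ler_wpM2l (ltW alpha_gt0) (inner_opnorm_young K_cont dk (y - yk) it0).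
rewrite -subr_ge0 -/n => young; rewrite -subr_ge0.
set r := (X in 0 <= X) in young; rewrite (_ : _ - _ = r) //.
by rewrite /energy /r; field; rewrite !lt0r_neq0.
Qed.

Hypothesis alpha_ge : 1 / (nu * sigma + 1) <= alpha.
Hypothesis nu_gt0 : 0 < nu.
Hypothesis c_gt0 : 0 < c.
Hypothesis beta_small : n ^+ 2 * beta ^+ 2 * sigma <
  c * (1 - alpha * tau * sigma * n ^+ 2).

(** The reals [gx], [g1], [hy], [h1] stand for g(x), g(x1), h(y), h(y1), and the hypotheses are the
    two proximal inequalities. Once these are added, the bilinear terms reduce to the cross terms of
    the two energies and two leftovers, alpha <K dk, y1 - yk> and beta <K (x - x1), y1 - yk>. *)
Lemma energy_step x y xk dk x1 yk y1 gx g1 hy h1 :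
  sigma^-1 * '[sigma *: K (xk + alpha *: dk) + yk - y1, y - y1] +
    nu / 2 * `|y - y1| ^+ 2 + h1 <= hy ->
  tau^-1 * '[- (tau *: Kstar (y1 + beta *: (y1 - yk))) + xk - x1, x - x1] +
    mu / 2 * `|x - x1| ^+ 2 + g1 <= gx ->
  ('[K x1, y] + g1 - hy) - ('[K x, y1] + gx - h1) <=
  energy x y xk dk yk - alpha^-1 * energy x y x1 (x1 - xk) y1.
Proof.
have -> : sigma^-1 * '[sigma *: K (xk + alpha *: dk) + yk - y1, y - y1] =
    '[K (xk + alpha *: dk), y - y1] + sigma^-1 / 2 *
      (`|y1 - yk| ^+ 2 + `|y - y1| ^+ 2 - `|y - yk| ^+ 2).
  rewrite -addrA innerDl innerZl mulrDr mulKf ?lt0r_neq0//.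
  by rewrite (distrC y1) -three_point; congr (_ + _); field; rewrite lt0r_neq0.
have -> : tau^-1 * '[- (tau *: Kstar (y1 + beta *: (y1 - yk))) + xk - x1,
      x - x1] =
    - '[K (x - x1), y1 + beta *: (y1 - yk)] + tau^-1 / 2 *
      (`|x1 - xk| ^+ 2 + `|x - x1| ^+ 2 - `|x - xk| ^+ 2).
  rewrite -addrA innerDl innerNl innerZl mulrDr mulrN mulKf ?lt0r_neq0//.
  rewrite (distrC x1) -three_point innerC Kstar_adj.
  by congr (_ + _); field; rewrite lt0r_neq0.
move=> Hh Hg.
(* The weight 1/tau reproduces the |dk|^2 term stored in the current energy. *)
have Y1 : alpha * '[K dk, y1 - yk] <= alpha * ((2 * tau)^-1 * `|dk| ^+ 2 +
    tau * n ^+ 2 / 2 * `|y1 - yk| ^+ 2).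
  rewrite ler_pM2l//.
  have it0 : 0 < tau^-1 by rewrite invr_gt0.
  apply: (le_trans (inner_opnorm_young K_cont _ _ it0)).
  rewrite -/n le_eqVlt; apply/orP; left.
  by apply/eqP; field; rewrite ?lt0r_neq0.
(* The weight c spends all of the |x - x1|^2 surplus, see [cx]. *)
have Y2 : '[K (x - x1), beta *: (y1 - yk)] <= c / 2 * `|x - x1| ^+ 2 +
    n ^+ 2 * beta ^+ 2 / (2 * c) * `|y1 - yk| ^+ 2.
  apply: (le_trans (inner_opnorm_young K_cont _ _ c_gt0)).
  rewrite normrZ exprMn real_normK ?num_real// -/n le_eqVlt; apply/orP; left.
  by apply/eqP; field; rewrite ?lt0r_neq0.
(* Both leftovers now charge |y1 - yk|^2. Divided by 2 c sigma, the condition on beta says that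
   their sum fits under the available 1 / (2 sigma). *)
have D_le : (alpha * tau * n ^+ 2 / 2 + n ^+ 2 * beta ^+ 2 / (2 * c)) *
    `|y1 - yk| ^+ 2 <= (2 * sigma)^-1 * `|y1 - yk| ^+ 2.
  rewrite ler_wpM2r ?sqr_ge0// -subr_ge0.
  have -> : (2 * sigma)^-1 -
      (alpha * tau * n ^+ 2 / 2 + n ^+ 2 * beta ^+ 2 / (2 * c)) =
    (c * (1 - alpha * tau * sigma * n ^+ 2) - n ^+ 2 * beta ^+ 2 * sigma) /
      (2 * c * sigma) by field; rewrite ?lt0r_neq0.
  by rewrite divr_ge0 ?subr_ge0 ?ltW// !mulr_gt0.
(* The strong convexity of h pays for the factor 1/alpha in y, since 1/alpha <= nu sigma + 1. *)
have y_le : alpha^-1 * (2 * sigma)^-1 * `|y - y1| ^+ 2 <=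
    (nu / 2 + (2 * sigma)^-1) * `|y - y1| ^+ 2.
  rewrite ler_wpM2r ?sqr_ge0//.
  have ns0 : 0 < nu * sigma + 1 by rewrite ltr_wpDl// mulr_ge0 ?ltW.
  have ia : alpha^-1 <= nu * sigma + 1.
    by rewrite -[leRHS]invrK lef_pV2 ?posrE ?invr_gt0// -div1r.
  have -> : nu / 2 + (2 * sigma)^-1 = (nu * sigma + 1) * (2 * sigma)^-1.
    by field; rewrite lt0r_neq0.
  by rewrite ler_wpM2r// invr_ge0 mulr_ge0// ltW.
(* c/2 is the coefficient given by the proximal inequality in x, less what the next energy over
   alpha requires. *)
have cx : c / 2 * `|x - x1| ^+ 2 =
    (mu / 2 + tau^-1 / 2 - alpha^-1 * (tau^-1 / 2)) * `|x - x1| ^+ 2.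
  by rewrite cE; field; rewrite !lt0r_neq0.
have energyE : alpha^-1 * energy x y x1 (x1 - xk) y1 =
    alpha^-1 * (2 * tau)^-1 * `|x - x1| ^+ 2 +
    alpha^-1 * (2 * sigma)^-1 * `|y - y1| ^+ 2 +
    (2 * tau)^-1 * `|x1 - xk| ^+ 2 - '[K (x1 - xk), y - y1].
  by rewrite /energy; field; rewrite !lt0r_neq0.
have KB u v : K (u - v) = K u - K v by exact: linearB.
have KD u v : K (u + v) = K u + K v by exact: linearD.
have KZ a u : K (a *: u) = a *: K u by exact: linearZ.
rewrite energyE; move: Hh Hg Y1 Y2 D_le y_le.
rewrite cx /energy !invfM !KB !KD !KZ !innerE; lra.
Qed.
End energy.

(** * Geometrically weighted averages and telescoping *)

Section geometric_averages.
Context (R : realType) (alpha : R).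
Hypothesis alpha_gt0 : 0 < alpha.
Let S k := \sum_(0 <= j < k.+1) alpha ^- j.

Let w_gt0 i : 0 < alpha ^- i.
Proof. by rewrite invr_gt0 exprn_gt0. Qed.

(** Source of the rate: dividing by the total weight gains at least a factor alpha^k. *)
Lemma geometric_weight_ge k : alpha ^- k <= S k.
Proof. by rewrite /S big_nat_recr//= lerDr sumr_ge0// => i _; exact: ltW. Qed.

Let S_gt0 k : 0 < S k.
Proof. exact: lt_le_trans (geometric_weight_ge k). Qed.

Lemma inner_geometric_average (H : hilbertType R) (x : nat -> H) v k :
  S k * '[geometric_average alpha x k, v] =
  \sum_(0 <= i < k.+1) alpha ^- i * '[x i.+1, v].
Proof.
rewrite innerZl mulVKf ?lt0r_neq0//.
elim: k.+1 => [|m IH]; first by rewrite !big_geq// linear0l.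
by rewrite !big_nat_recr//= innerDl IH innerZl.
Qed.

Lemma econvex_geometric_average (H : hilbertType R) (g : H -> \bar R)
    (x : nat -> H) k :
  econvex g -> (forall i, g (x i.+1) \is a fin_num) ->
  (g (geometric_average alpha x k) <=
   ((S k)^-1 * \sum_(0 <= i < k.+1) alpha ^- i * fine (g (x i.+1)))%:E)%E.
Proof.
move=> g_cvx gx.
exact: (@econvex_weighted_average _ _ _ (fun i => alpha ^- i) (x \o succn)).
Qed.

(** The distance to z is a convex function, so Jensen applies to it. *)
Lemma geometric_average_bounded (H : hilbertType R) (x : nat -> H) z B k :
  (forall i, `|z - x i.+1| <= B) -> `|z - geometric_average alpha x k| <= B.
Proof.
move=> xB.
have cvx : econvex (fun u : H => `|z - u|%:E).
  move=> u v t /andP[t0 t1]; rewrite -!EFinM -EFinD lee_fin.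
  have -> : z - (t *: u + (1 - t) *: v) = t *: (z - u) + (1 - t) *: (z - v).
    rewrite !scalerBr addrACA -scalerDl -opprD.
    by congr (_ - _); rewrite addrCA subrr addr0 scale1r.
  apply: (le_trans (ler_normD _ _)).
  by rewrite !normrZ !ger0_norm ?subr_ge0.
have := @econvex_geometric_average _ _ x k cvx (fun=> erefl).
rewrite lee_fin => /le_trans; apply.
rewrite ler_pdivrMl// /S mulr_suml; apply: ler_sum => i _.
by rewrite ler_wpM2l ?xB ?(ltW (w_gt0 i)).
Qed.

(** The final energy is kept on the left: it is what later bounds the iterates. *)
Lemma geometric_telescope (L E : nat -> R) k :
  (forall i, L i <= E i - alpha^-1 * E i.+1) ->
  \sum_(0 <= i < k) alpha ^- i * L i + alpha ^- k * E k <= E 0%N.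
Proof.
move=> LE; elim: k => [|k IH].
  by rewrite big_geq// add0r expr0 invr1 mul1r.
rewrite big_nat_recr//=; apply: le_trans IH; rewrite -addrA lerD2l.
have := ler_wpM2l (ltW (w_gt0 k)) (LE k).
by rewrite exprSr invfM; lra.
Qed.

End geometric_averages.

(** * Linear convergence from a geometric bound, and finiteness at a saddle-point *)

Lemma converges_linearly_geometric (R : realType) (v : nat -> R) (l r M : R) :
  0 < r < 1 -> 0 < M -> (forall k, `|v k - l| <= r ^+ k * M) ->
  converges_linearly (fun k => (v k)%:E) l%:E r.
Proof.
move=> /andP[r0 r1] M0 vM; split; first by rewrite r0.
  apply: cvg_EFin; first exact: nearW.
  have rM : (fun k => r ^+ k * M) @ \oo --> (0 : R).
    rewrite -[X in _ --> X](mul0r M); apply: cvgMr_tmp.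
    by apply: cvg_expr; rewrite gtr0_norm.
  apply: (@squeeze_cvgr _ _ _ _ (fun k => l - r ^+ k * M)
    (fun k => l + r ^+ k * M)).
  - by apply: nearW => k; have := vM k; rewrite ler_norml /=; lra.
  - by rewrite -[X in _ --> X]subr0; apply: cvgB => //; exact: cvg_cst.
  - by rewrite -[X in _ --> X]addr0; apply: cvgD => //; exact: cvg_cst.
by exists M => // k; rewrite -EFinB lee_fin.
Qed.

(** Compare with (x, y) where g(x) and h(y) are finite. If only g(xs) is infinite, f(xs, ys) = +oo
    exceeds f(x, ys); if h(ys) is infinite, f(xs, ys) = -oo, also when g(xs) = +oo, and lies below
    f(xs, y). *)
Lemma saddle_point_fin_num (R : realType) (H1 H2 : hilbertType R) (K : H1 -> H2)
    (g : H1 -> \bar R) (h : H2 -> \bar R) xs ys :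
  proper_function g -> proper_function h ->
  saddle_point (bilinear_saddle_function K g h) xs ys ->
  g xs \is a fin_num /\ h ys \is a fin_num.
Proof.
move=> gP hP saddle; have [[x gx] [y hy]] := (gP.2, hP.2).
have gxf := proper_fin_num gP gx; have hyf := proper_fin_num hP hy.
have [le1 le2] := saddle x y; move: le1 le2.
rewrite /bilinear_saddle_function -(fineK gxf) -(fineK hyf).
have := gP.1 xs; have := hP.1 ys.
by case: (g xs) => [a| |]; case: (h ys) => [b| |];
  rewrite ?ltxx //= ?leye_eq ?leeNy_eq.
Qed.

(** * Gap estimate at the averages, boundedness and the two-sided bound *)

Theorem corollary4p1 (R : realType) (H1 H2 : hilbertType R)
  (K : {linear H1 -> H2}) (Kstar : H2 -> H1)
  (K_cont : continuous K) (Kstar_adj : is_adjoint K Kstar)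
  (g : H1 -> \bar R) (h : H2 -> \bar R)
  (g_proper : proper_function g) (g_lsc : lower_semicontinuous g)
  (h_proper : proper_function h) (h_lsc : lower_semicontinuous h)
  (mu nu : R) (mu_gt0 : 0 < mu) (nu_gt0 : 0 < nu)
  (g_sc : strongly_convex mu g) (h_sc : strongly_convex nu h)
  (xs : H1) (ys : H2)
  (f := bilinear_saddle_function K g h)
  (xs_ys_saddle : saddle_point f xs ys)
  (tau sigma alpha beta : R)
  (tau_gt0 : 0 < tau) (sigma_gt0 : 0 < sigma)
  (alpha_gt0 : 0 < alpha) (beta_ge0 : 0 <= beta)
  (x xbar : nat -> H1) (y ybar : nat -> H2)
  (xy_gen : alternating_proximal_mapping_method K Kstar g h
     (fun=> tau) (fun=> sigma) (fun=> alpha) (fun=> beta) x xbar y ybar)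
  (nK := opnorm K)
  (small_sigma : nK ^+ 2 < (mu + 1 / tau) / sigma)
  (small_tau : nK ^+ 2 < (nu + 1 / sigma) / tau)
  (alpha_gt : 1 / (mu * tau + 1) < alpha) (alpha_lt1 : alpha < 1)
  (alpha_ge : 1 / (nu * sigma + 1) <= alpha)
  (alpha_small : alpha * tau * sigma * nK ^+ 2 < 1)
  (beta_small : nK ^+ 2 * beta ^+ 2 * sigma <
     (mu + 1 / tau - 1 / (alpha * tau)) * (1 - alpha * tau * sigma * nK ^+ 2))
  (eta1 eta2 eta3 eta4 : R)
  (eta4_gt0 : 0 < eta4) (tau_le_eta4 : tau <= eta4)
  (eta4_small : alpha * sigma * eta4 * nK ^+ 2 < 1)
  (eta1_gt0 : 0 < eta1) (eta2_gt0 : 0 < eta2) (eta3_gt0 : 0 < eta3)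
  (etas :
    [/\ sigma * nK / (1 - alpha * tau * sigma * nK ^+ 2) < eta3,
        eta3 * nK * beta ^+ 2 <= mu + 1 / tau - 1 / (alpha * tau),
        sigma * nK * eta3 / (eta3 - sigma * nK) <= eta1,
        alpha * tau * eta1 * nK < 1 &
        tau * nK / (alpha - tau * eta1 * nK * alpha ^+ 2) <= eta2]
    \/
    [/\ sigma / (1 - alpha * tau * sigma * nK ^+ 2) < eta3,
        nK ^+ 2 * beta ^+ 2 * eta3 <= mu + 1 / tau - 1 / (alpha * tau),
        sigma * eta3 / (eta3 - sigma) <= eta1,
        alpha * tau * eta1 * nK ^+ 2 < 1 &
        tau / (alpha * (1 - alpha * tau * eta1 * nK ^+ 2)) <= eta2])
  (xhat := geometric_average alpha x) (yhat := geometric_average alpha y) :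
  (exists2 M : R, 0 < M & forall k : nat,
     let bound1 := alpha ^+ k * (1 / (2 * tau) * `|xs - x 0%N| ^+ 2 +
                                 1 / (2 * sigma) * `|yhat k - y 0%N| ^+ 2) in
     let bound2 := alpha ^+ k * (1 / (2 * tau) * `|xhat k - x 0%N| ^+ 2 +
                                 1 / (2 * sigma) * `|ys - y 0%N| ^+ 2) in
     [/\ (f (xhat k) (yhat k) - f xs ys <= bound1%:E)%E,
         bound1 <= alpha ^+ k * M,
         (f xs ys - f (xhat k) (yhat k) <= bound2%:E)%E &
         bound2 <= alpha ^+ k * M])
  /\ converges_linearly (fun k => f (xhat k) (yhat k)) (f xs ys) alpha.
Proof.
pose c := mu + 1 / tau - 1 / (alpha * tau).
have c0 : 0 < c.
  have mt0 : 0 < mu * tau + 1 by rewrite ltr_wpDl// mulr_ge0 ?ltW.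
  have -> : c = (alpha * (mu * tau + 1) - 1) / (alpha * tau).
    by rewrite /c; field; rewrite !lt0r_neq0.
  by rewrite divr_gt0 ?mulr_gt0// subr_gt0 -ltr_pdivrMr.
have [_ _ method] := xy_gen.
(* Finiteness starts at index 1, where proximal points begin: g may be infinite at the initial
   point. The averages also start there. *)
have gx i : g (x i.+1) \is a fin_num.
  by have [_ _ /(Prox_fin_num g_proper tau_gt0)] := method i.
have hy i : h (y i.+1) \is a fin_num.
  by have [/(Prox_fin_num h_proper sigma_gt0)] := method i.
have [gxs hys] := saddle_point_fin_num g_proper h_proper xs_ys_saddle.
(* Truncated predecessor: d 0 = 0, matching x^{-1} = x^0. *)
pose d k := x k - x k.-1.
have xbarE k : xbar k = x k + alpha *: d k.
  case: k => [|k]; last by have [] := method k.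
  by rewrite /d subrr scaler0 addr0; case: xy_gen.
have ybarE k : ybar k.+1 = y k.+1 + beta *: (y k.+1 - y k).
  by have [] := method k.
pose L X Y i := ('[K (x i.+1), Y] + fine (g (x i.+1)) - fine (h Y)) -
                ('[K X, y i.+1] + fine (g X) - fine (h (y i.+1))).
pose E X Y i := energy K tau sigma alpha X Y (x i) (d i) (y i).
have step X Y i : g X \is a fin_num -> h Y \is a fin_num ->
    L X Y i <= E X Y i - alpha^-1 * E X Y i.+1.
  move=> gX hY; have [yP _ xP _] := method i.
  apply: (energy_step K_cont Kstar_adj tau_gt0 sigma_gt0 alpha_gt0
    (erefl c) alpha_ge nu_gt0 c0 beta_small).
    rewrite -xbarE.
    exact: (Prox_strongly_convex h_proper h_sc sigma_gt0 yP hY).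
  rewrite -ybarE.
  exact: (Prox_strongly_convex g_proper g_sc tau_gt0 xP gX).
pose D X Y :=
  (2 * tau)^-1 * `|X - x 0%N| ^+ 2 + (2 * sigma)^-1 * `|Y - y 0%N| ^+ 2.
have it0 : 0 < (2 * tau)^-1 by rewrite invr_gt0 mulr_gt0.
have is0 : 0 < (2 * sigma)^-1 by rewrite invr_gt0 mulr_gt0.
have D_ge0 X Y : 0 <= D X Y by rewrite addr_ge0// mulr_ge0 ?sqr_ge0// ltW.
(* Since d 0 = 0, the initial energy reduces to the distances in the claimed bounds. *)
have E0 X Y : E X Y 0%N = D X Y.
  by rewrite /E /energy /d subrr linear0 linear0l normr0 !mulr0 subr0 expr0n/=
     mulr0 addr0.
pose s := (1 - alpha * tau * sigma * nK ^+ 2) / (2 * sigma).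
have s0 : 0 < s by rewrite divr_gt0 ?mulr_gt0// subr_gt0.
have E_ge X Y i :
    (2 * tau)^-1 * `|X - x i| ^+ 2 + s * `|Y - y i| ^+ 2 <= E X Y i.
  exact: energy_ge.
have E_ge0 X Y i : 0 <= E X Y i.
  by apply: le_trans (E_ge X Y i); rewrite addr_ge0// mulr_ge0 ?sqr_ge0// ltW.
have telescope X Y k : g X \is a fin_num -> h Y \is a fin_num ->
    \sum_(0 <= i < k) alpha ^- i * L X Y i + alpha ^- k * E X Y k <= D X Y.
  move=> gX hY; rewrite -E0; apply: geometric_telescope => // i; exact: step.
have w0 i : 0 < alpha ^- i by rewrite invr_gt0 exprn_gt0.
pose S k := \sum_(0 <= j < k.+1) alpha ^- j.
have S0 k : 0 < S k by exact: lt_le_trans (geometric_weight_ge alpha_gt0 k).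
have avg (H : hilbertType R) (q : H -> \bar R) (u : nat -> H) k :
    proper_function q -> econvex q -> (forall i, q (u i.+1) \is a fin_num) ->
    q (geometric_average alpha u k) \is a fin_num /\
    S k * fine (q (geometric_average alpha u k)) <=
      \sum_(0 <= i < k.+1) alpha ^- i * fine (q (u i.+1)).
  move=> qP q_cvx qu; have qa := econvex_geometric_average alpha_gt0 k q_cvx qu.
  have qf : q (geometric_average alpha u k) \is a fin_num.
    by apply: proper_fin_num => //; apply: le_lt_trans qa _; rewrite ltry.
  by split=> //; rewrite -ler_pdivlMl// -lee_fin fineK.
have gxhat k := avg _ g x k g_proper g_sc.1 gx.
have hyhat k := avg _ h y k h_proper h_sc.1 hy.
(* X and Y stay arbitrary because they will be taken to depend on k: (xs, [yhat k]) for one bound,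
   ([xhat k], ys) for the other. *)
have gap X Y k : g X \is a fin_num -> h Y \is a fin_num ->
    ('[K (xhat k), Y] + fine (g (xhat k)) - fine (h Y)) -
    ('[K X, yhat k] + fine (g X) - fine (h (yhat k))) <= alpha ^+ k * D X Y.
  move=> gX hY; apply: (@le_trans _ _ ((S k)^-1 * D X Y)); last first.
    rewrite ler_wpM2r// -[leRHS]invrK lef_pV2 ?posrE//.
    exact: geometric_weight_ge.
  rewrite ler_pdivlMl//; apply: le_trans (telescope X Y k.+1 gX hY).
  apply: (@le_trans _ _ (\sum_(0 <= i < k.+1) alpha ^- i * L X Y i));
    last first.
    by rewrite lerDl mulr_ge0// ltW.
  have -> : \sum_(0 <= i < k.+1) alpha ^- i * L X Y i =
      \sum_(0 <= i < k.+1) alpha ^- i * '[x i.+1, Kstar Y] +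
      \sum_(0 <= i < k.+1) alpha ^- i * fine (g (x i.+1)) - S k * fine (h Y) -
      (\sum_(0 <= i < k.+1) alpha ^- i * '[y i.+1, K X] + S k * fine (g X) -
       \sum_(0 <= i < k.+1) alpha ^- i * fine (h (y i.+1))).
    rewrite /S; elim: k.+1 => [|m IH]; first by rewrite !big_geq//; ring.
    rewrite !big_nat_recr//= IH /L -Kstar_adj (innerC (K X)); ring.
  rewrite -!inner_geometric_average// -/(S k) -/(xhat k) -/(yhat k).
  rewrite -Kstar_adj (innerC (K X)).
  have := (gxhat k).2; have := (hyhat k).2; rewrite -/(xhat k) -/(yhat k).
  lra.
have fE X Y : g X \is a fin_num -> h Y \is a fin_num ->
    f X Y = ('[K X, Y] + fine (g X) - fine (h Y))%:E.
  by move=> gX hY; rewrite /f /bilinear_saddle_function EFinB EFinD !fineK.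
have L_ge0 i : 0 <= L xs ys i.
  have [le1 le2] := xs_ys_saddle (x i.+1) (y i.+1).
  have := le_trans le1 le2; rewrite -/f !fE// lee_fin /L; lra.
have E_le i : E xs ys i <= D xs ys.
  apply: (@le_trans _ _ (alpha ^- i * E xs ys i)).
    by rewrite ler_peMl// invf_ge1 ?exprn_gt0// exprn_ile1// ltW.
  apply: le_trans (telescope xs ys i gxs hys); rewrite lerDr.
  by apply: sumr_ge0 => j _; rewrite mulr_ge0// ltW.
(* The crude bound b <= b^2 + 1 avoids square roots. *)
have norm_le a b : 0 < a -> 0 <= b -> a * b ^+ 2 <= D xs ys ->
    b <= D xs ys / a + 1.
  move=> a0 b0; rewrite mulrC -ler_pdivlMr//; nra.
pose Bx := D xs ys / (2 * tau)^-1 + 1.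
pose By := D xs ys / s + 1.
have xB i : `|xs - x i| <= Bx.
  apply: norm_le => //; apply: le_trans (E_le i); apply: le_trans (E_ge _ _ _).
  by rewrite lerDl mulr_ge0 ?sqr_ge0// ltW.
have yB i : `|ys - y i| <= By.
  apply: norm_le => //; apply: le_trans (E_le i); apply: le_trans (E_ge _ _ _).
  by rewrite lerDr mulr_ge0 ?sqr_ge0// ltW.
have xhatB k : `|xhat k - x 0%N| <= Bx + Bx.
  apply: (le_trans (ler_distD xs _ _)); rewrite (distrC _ xs) lerD//.
  exact: geometric_average_bounded.
have yhatB k : `|yhat k - y 0%N| <= By + By.
  apply: (le_trans (ler_distD ys _ _)); rewrite (distrC _ ys) lerD//.
  exact: geometric_average_bounded.
have sqr_le (a b : R) : 0 <= a -> a <= b -> a ^+ 2 <= b ^+ 2.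
  by move=> a0 ab; rewrite ler_sqr ?nnegrE// (le_trans a0).
(* Collecting all four squared distances makes M dominate both right-hand sides; the added 1 gives
   positivity at once. *)
pose M := (2 * tau)^-1 * (`|xs - x 0%N| ^+ 2 + (Bx + Bx) ^+ 2) +
  (2 * sigma)^-1 * (`|ys - y 0%N| ^+ 2 + (By + By) ^+ 2) + 1.
have DxM k : D xs (yhat k) <= M.
  have := sqr_ge0 (Bx + Bx); have := sqr_ge0 `|ys - y 0%N|.
  have := sqr_le _ _ (normr_ge0 _) (yhatB k); rewrite /D /M; nra.
have DyM k : D (xhat k) ys <= M.
  have := sqr_ge0 (By + By); have := sqr_ge0 `|xs - x 0%N|.
  have := sqr_le _ _ (normr_ge0 _) (xhatB k); rewrite /D /M; nra.
have M0 : 0 < M.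
  by rewrite /M ltr_wpDl// addr_ge0// mulr_ge0 ?addr_ge0 ?sqr_ge0// ltW.
have ak k : 0 <= alpha ^+ k by rewrite exprn_ge0// ltW.
pose v k := '[K (xhat k), yhat k] + fine (g (xhat k)) - fine (h (yhat k)).
have fvE k : f (xhat k) (yhat k) = (v k)%:E.
  by rewrite fE ?(gxhat k).1 ?(hyhat k).1.
pose l := '[K xs, ys] + fine (g xs) - fine (h ys).
have flE : f xs ys = l%:E by rewrite fE.
(* As f(xs, [yhat k]) <= f(xs, ys), the difference is at most the gap at (xs, [yhat k]); [l_le] is
   the mirror image. *)
have v_le k : v k - l <= alpha ^+ k * D xs (yhat k).
  have [le1 _] := xs_ys_saddle xs (yhat k).
  have := gap xs (yhat k) k gxs (hyhat k).1.
  by move: le1; rewrite -/f flE fE ?(hyhat k).1// lee_fin -/(v k); lra.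
have l_le k : l - v k <= alpha ^+ k * D (xhat k) ys.
  have [_ le2] := xs_ys_saddle (xhat k) ys.
  have := gap (xhat k) ys k (gxhat k).1 hys.
  by move: le2; rewrite -/f flE fE ?(gxhat k).1// lee_fin -/(v k) /v; lra.
split.
  exists M => // k /=; rewrite !div1r fvE flE -!EFinB !lee_fin.
  by split; rewrite ?v_le ?l_le// ler_wpM2l ?DxM ?DyM.
rewrite flE (_ : (fun k => _) = (fun k => (v k)%:E)); last exact/funext.
apply: (@converges_linearly_geometric _ _ _ _ M) => //.
  by rewrite alpha_gt0.
move=> k; rewrite ler_norml; have := v_le k; have := l_le k.
have := ler_wpM2l (ak k) (DxM k); have := ler_wpM2l (ak k) (DyM k); lra.
Qed.
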